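(* Let $n\ge 1$ and let $X$ be a random vector in $\mathbb{R}^n$ with a log-concave density $f$. Let $\widetilde h(X)=-\log f(X)$ and $h(X)=\mathbf{E}\,\widetilde h(X)$. Then for every $0\le\varepsilon\le 2$, $$\mathbf{P}\left\{\left|\frac{\widetilde h(X)}{n}-\frac{h(X)}{n}\right|\ge\varepsilon\right\}\le 4e^{-\varepsilon^2 n/16}.$$
   Context: The density is with respect to Lebesgue measure on $\mathbb{R}^n$. A density $f$ is log-concave if $f(tx+(1-t)y)\ge f(x)^t f(y)^{1-t}$ for all $x,y\in\mathbb{R}^n$ and $t\in(0,1)$. The random variable $\widetilde h(X)=-\log f(X)$ (natural logarithm) is called the information content of $X$; its expectation is the Shannon entropy $h(X)=-\int_{\mathbb{R}^n} f\log f$. *)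

(* Defs.v *)
From HB Require Import structures.
From mathcomp Require Import all_boot all_order all_algebra.
From mathcomp Require Import all_classical all_reals all_analysis.

Set Implicit Arguments.
Unset Strict Implicit.
Unset Printing Implicit Defensive.

Import Order.TTheory GRing.Theory Num.Theory.
Import numFieldNormedType.Exports.

Local Open Scope classical_set_scope.
Local Open Scope ring_scope.
Local Open Scope ereal_scope.

(* R^n is n.-tuple (measurableTypeR R), whose sigma-algebra in the library is
   the one generated by the coordinate maps, i.e. the Borel sets of R^n. *)
Definition tuple_of_pair (R : realType) (n : nat)
    (p : (measurableTypeR R * n.-tuple (measurableTypeR R))%type) :
  n.+1.-tuple (measurableTypeR R) := [tuple of p.1 :: p.2].

Fixpoint lebesgue_measure_tuple (R : realType) (n : nat) :
    set (n.-tuple (measurableTypeR R)) -> \bar R :=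
  match n with
  | 0 => \d_ ([tuple] : 0.-tuple (measurableTypeR R))
  | m.+1 => pushforward (lebesgue_measure \x @lebesgue_measure_tuple R m)
              (@tuple_of_pair R m)
  end.
Arguments lebesgue_measure_tuple {R n}.

Section lebesgue_measure_tuple_measure.
Variable R : realType.
Local Notation RT := (measurableTypeR R).

Lemma measurable_tuple_of_pair n : measurable_fun setT (@tuple_of_pair R n).
Proof. exact: measurable_cons. Qed.

Section step.
Context n (mu : {sigma_finite_measure set (n.-tuple RT) -> \bar R}).
Let nu := pushforward (lebesgue_measure \x mu) (@tuple_of_pair R n).

Let nu0 : nu set0 = 0.
Proof. by rewrite /nu /pushforward preimage_set0 measure0. Qed.

Let nu_ge0 A : 0 <= nu A.
Proof. exact: (measure_ge0 (lebesgue_measure \x mu)%E). Qed.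

Let nu_sigma_additive : semi_sigma_additive nu.
Proof.
apply: (@measure_semi_sigma_additive _ _ _
  (measure_function_pushforward__canonical__measure_function_Measure
     (lebesgue_measure \x mu) (@measurable_tuple_of_pair n))).
Qed.

HB.instance Definition _ := isMeasure.Build _ _ _ nu
  nu0 nu_ge0 nu_sigma_additive.

Let nu_sigma_finite : sigma_finite setT nu.
Proof.
have [F FT Foo] : sigma_finite setT (lebesgue_measure \x mu).
  have /sigma_finiteP[F [TF ndF Foo]] := sigma_finiteT (@lebesgue_measure R).
  have /sigma_finiteP[G [TG ndG Goo]] := sigma_finiteT mu.
  exists (fun k => F k `*` G k).
    rewrite -setXTT TF TG; apply/seteqP; split => -[x y] /=.
      move=> [[i _ Fi] [j _ Gj]]; exists (maxn i j) => //; split => /=.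
        by move: x Fi; exact/subsetPset/ndF/leq_maxl.
      by move: y Gj; exact/subsetPset/ndG/leq_maxr.
    by move=> [i _ [/= ? ?]]; split; exists i.
  move=> k; have [? ?] := Foo k; have [? ?] := Goo k.
  split; first exact: measurableX.
  by rewrite product_measure1E// lte_mul_pinfty// ge0_fin_numE.
pose u (x : n.+1.-tuple RT) : RT * n.-tuple RT :=
  (thead x, [tuple of behead x]).
have mu' : measurable_fun setT u.
  apply: measurable_fun_pair; first exact: measurable_tnth.
  exact: measurable_behead.
have uK p : u (@tuple_of_pair R n p) = p.
  by case: p => a b; rewrite /u theadE; congr pair; exact/val_inj.
exists (fun i => u @^-1` F i).
  apply/seteqP; split => // x _.
  have : [set: RT * n.-tuple RT] (u x) by [].
  by rewrite FT => -[i _ Fi]; exists i.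
move=> i; split.
  by rewrite -[X in measurable X]setTI; apply: mu' => //; exact: (Foo i).1.
rewrite /nu /pushforward -comp_preimage (_ : u \o _ = id).
  by rewrite preimage_id; exact: (Foo i).2.
by apply/funext => p; exact: uK.
Qed.

HB.instance Definition _ := Measure_isSigmaFinite.Build _ _ _ nu
  nu_sigma_finite.

Lemma lebesgue_measure_tuple_step :
  exists mu' : {sigma_finite_measure set (n.+1.-tuple RT) -> \bar R},
    mu' = nu :> (set _ -> \bar R).
Proof. by exists nu. Qed.

End step.

Lemma lebesgue_measure_tuple_ex n :
  exists mu : {sigma_finite_measure set (n.-tuple RT) -> \bar R},
    mu = @lebesgue_measure_tuple R n :> (set (n.-tuple RT) -> \bar R).
Proof.
elim: n => [|n [mu /= <-]]; last exact: lebesgue_measure_tuple_step.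
by exists \d_ ([tuple] : 0.-tuple RT).
Qed.

Context {n : nat}.
Local Notation leb := (@lebesgue_measure_tuple R n).

Let leb0 : leb set0 = 0.
Proof. by have [mu <-] := lebesgue_measure_tuple_ex n. Qed.

Let leb_ge0 A : 0 <= leb A.
Proof. by have [mu <-] := lebesgue_measure_tuple_ex n. Qed.

Let leb_sigma_additive : semi_sigma_additive leb.
Proof.
have [mu <-] := lebesgue_measure_tuple_ex n.
exact: measure_semi_sigma_additive.
Qed.

HB.instance Definition _ := isMeasure.Build _ _ _ leb
  leb0 leb_ge0 leb_sigma_additive.

Let leb_sigma_finite : sigma_finite setT leb.
Proof.
have [mu <-] := lebesgue_measure_tuple_ex n.
exact: sigma_finiteT.
Qed.

HB.instance Definition _ := Measure_isSigmaFinite.Build _ _ _ leb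
  leb_sigma_finite.

End lebesgue_measure_tuple_measure.

Lemma lebesgue_measure_tuple_box (R : realType) (n : nat)
    (A : 'I_n -> set (measurableTypeR R)) :
  (forall i, measurable (A i)) ->
  lebesgue_measure_tuple [set x | forall i, A i (tnth x i)] =
  \prod_(i < n) lebesgue_measure (A i).
Proof.
elim: n A => [|n IH] A mA.
  rewrite big_ord0 /= (_ : [set x | _] = setT) ?diracT//.
  by apply/seteqP; split => // x _ [].
rewrite big_ord_recl -IH; last by move=> i; exact: mA.
rewrite /= -product_measure1E//=.
  rewrite /pushforward; congr (_ _); apply/seteqP; split => -[a b] /=.
    move=> h; split; first exact: (h ord0).
    by move=> i; have := h (lift ord0 i); rewrite tnthS.
  move=> [h1 h2] i; case: (unliftP ord0 i) => [j ->|->]//.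
  by rewrite tnthS.
rewrite (_ : [set x | _] = \bigcap_(i in [set: 'I_n])
   ((fun x : n.-tuple (measurableTypeR R) => tnth x i) @^-1` (A (lift ord0 i)))).
  apply: fin_bigcap_measurable => [|i _]; first exact: finite_finset.
  by rewrite -[X in measurable X]setTI; apply: measurable_tnth.
by apply/seteqP; split => x h i //=; exact: h.
Qed.

Definition is_density (R : realType) (n : nat) (d : measure_display)
    (T : measurableType d) (P : probability T R)
    (X : {RV P >-> n.-tuple (measurableTypeR R)})
    (f : n.-tuple (measurableTypeR R) -> R) : Prop :=
  [/\ measurable_fun [set: n.-tuple (measurableTypeR R)] f,
      forall x, (0 <= f x)%R &
      forall A, measurable A ->
        distribution P X A = \int[lebesgue_measure_tuple]_(x in A) (f x)%:E].

(* t x + (1 - t) y in R^n *)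
Definition tuple_conv (R : realType) (n : nat) (t : R)
    (x y : n.-tuple (measurableTypeR R)) : n.-tuple (measurableTypeR R) :=
  [tuple (t * tnth x i + (1 - t) * tnth y i)%R | i < n].

Definition log_concave (R : realType) (n : nat)
    (f : n.-tuple (measurableTypeR R) -> R) : Prop :=
  forall (x y : n.-tuple (measurableTypeR R)) (t : R), (0 < t < 1)%R ->
    (f x `^ t * f y `^ (1 - t) <= f (tuple_conv t x y))%R.

(* lne is the extended logarithm: this is +oo where the density vanishes. *)
Definition information_content (R : realType) (n : nat)
    (f : n.-tuple (measurableTypeR R) -> R)
    (x : n.-tuple (measurableTypeR R)) : \bar R := - lne (f x)%:E.

(* h(X) = E(- log f(X)), written as an integral because 'E_P is restricted to
   real-valued functions. *)
Definition shannon_entropy (R : realType) (n : nat) (d : measure_display)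
    (T : measurableType d) (P : probability T R)
    (X : {RV P >-> n.-tuple (measurableTypeR R)})
    (f : n.-tuple (measurableTypeR R) -> R) : \bar R :=
  \int[P]_w information_content f (X w).

(* Main.v *)
Require Import Defs.
From HB Require Import structures.
From mathcomp Require Import all_boot all_order all_algebra.
From mathcomp Require Import all_classical all_reals all_analysis.
From mathcomp Require Import measurable_realfun.
From mathcomp Require Import ring lra.

Set Implicit Arguments.
Unset Strict Implicit.
Unset Printing Implicit Defensive.

Import Order.TTheory GRing.Theory Num.Theory.
Import numFieldNormedType.Exports.

Local Open Scope classical_set_scope.
Local Open Scope ring_scope.
Local Open Scope ereal_scope.

(** Write F(p) for the integral of f ^ p over R^n.  Everything rests on one
    inequality for the log-concave density f: for 0 < b < 1,

      (1 - b^2)^n F(1 - b) F(1 + b) <= F(1)^2 = 1,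

    which is the midpoint case of the log-concavity of p |-> p^n F(p)
    ([log_concave_moments]).  It is a Prekopa-Leindler inequality read off at an
    off-centre point: with s = (1 - b) / 2, log-concavity of f gives
    f(x)^(1-b) f(y)^(1+b) <= f(s x + (1 - s) y)^2, and the fact that the weights
    s, 1 - s of the points differ from the weights 1/2, 1/2 of the exponents
    improves the integrated inequality by a factor 4 s (1 - s) = 1 - b^2 for each
    dimension ([prekopa_leindler]).  By Tonelli that inequality follows from its
    one-dimensional case by induction on n; on the line one integrates the bound
    s |A| + (1 - s) |B| <= |s A + (1 - s) B| over the level sets
    ([brunn_minkowski_line], [layer_cake]) and concludes with
    (x + y)^2 >= 4 x y.

    In terms of L = - log f(X), the inequality says
    (1 - b^2)^n E(e^(bL)) E(e^(-bL)) <= 1.  Hence both exponential moments are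
    finite, so the entropy h = E(L) is finite, and Jensen's inequality bounds
    each of them from below by e^(bh) and e^(-bh).  Dividing by the lower bound
    for one moment gives an upper bound for the other: E(e^(b(L-h))) and
    E(e^(-b(L-h))) are at most (1 - b^2)^(-n).  Markov's inequality gives
      P(|L - h| >= n eps) <= 2 (1 - b^2)^(-n) e^(-b n eps)
    ([exp_moments_concentration]), and b = eps / 4 <= 1/2 with
    1 - b^2 >= e^(-2 b^2) makes the right-hand side at most
    2 e^(-eps^2 n / 8), which is below the claimed bound.  The event f(X) = 0, where the
    information content is infinite, is negligible. *)

(** * The Brunn-Minkowski inequality on the line *)

Section line.
Context {R : realType}.
Local Notation RT := (measurableTypeR R).
Local Notation lam := (@lebesgue_measure R).

Lemma measurable_affine (s c : R) :
  measurable_fun [set: RT] (fun z : RT => (s^-1 * (z - c))%R : RT).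
Proof.
by apply: (@measurable_funM _ RT R) => //; exact: (@measurable_funB _ RT R).
Qed.

(** The set is the image of A under x |-> s x + c; the preimage form makes it
    visibly measurable.  Half-open intervals scale by s, and they determine the
    Lebesgue measure. *)
Lemma lebesgue_measure_affine (s c : R) (A : set RT) : (0 < s)%R ->
  measurable A -> lam [set z | A (s^-1 * (z - c))%R] = s%:E * lam A.
Proof.
move=> s0 mA.
have si0 : (0 <= s^-1)%R by rewrite invr_ge0 ltW.
pose phi := (fun z : RT => (s^-1 * (z - c))%R : RT).
pose m := mscale (NngNum si0)
  (measure_function_pushforward__canonical__measure_function_Measure
     lam (measurable_affine s c)).
have mE B : m B = s^-1%:E * lam (phi @^-1` B) by [].
have -> : lam A = m A.
  apply: lebesgue_measure_unique => //= _ [[a b]] _ <-.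
  rewrite [RHS]mE.
  have -> : phi @^-1` `]a, b] = `](s * a + c)%R, (s * b + c)%R]%classic.
    apply/seteqP; split => z /=; rewrite !in_itv/= /phi => /andP[h1 h2].
      have : (s * a < z - c)%R by rewrite mulrC -ltr_pdivlMr// mulrC.
      have : (z - c <= s * b)%R by rewrite mulrC -ler_pdivrMr// mulrC.
      by move=> ? ?; apply/andP; split; lra.
    rewrite mulrC ltr_pdivlMr// ler_pdivrMr//.
    by apply/andP; split; lra.
  rewrite !lebesgue_measure_itv/= !lte_fin ltrD2r ltr_pM2l//.
  case: ifPn => ab; last by rewrite mule0.
  rewrite -!EFinD -EFinM; congr EFin; field; exact: lt0r_neq0.
by rewrite mE muleA -EFinM mulfV ?mul1e// lt0r_neq0.
Qed.

Lemma measurable_affine_preimage (s c : R) (A : set RT) : measurable A ->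
  measurable [set z : RT | A (s^-1 * (z - c))%R].
Proof. by move=> mA; rewrite -[X in measurable X]setTI; exact: measurable_affine. Qed.

(** If a were the supremum of A and b the infimum of B, then s A + (1 - s) b and
    s a + (1 - s) B would be subsets of C meeting in at most one point.  Since a and
    b are only almost extremal, the overlap is an interval [p, q] of length at most
    e. *)
Lemma bounded_brunn_minkowski (s M : R) (A B C : set RT) : (0 < s < 1)%R ->
  measurable A -> measurable B -> measurable C ->
  A `<=` [set` `[- M, M]%R] -> B `<=` [set` `[- M, M]%R] ->
  A !=set0 -> B !=set0 ->
  (forall a b, A a -> B b -> C (s * a + (1 - s) * b)%R) ->
  s%:E * lam A + (1 - s)%:E * lam B <= lam C.
Proof.
move=> /andP[s0 s1] mA mB mC AM BM A0 B0 ABC.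
have s10 : (0 < 1 - s)%R by rewrite subr_gt0.
have supA : has_sup A.
  by split => //; exists M => x /AM /=; rewrite in_itv/= => /andP[].
have infB : has_inf B.
  by split => //; exists (- M)%R => x /BM /=; rewrite in_itv/= => /andP[].
apply/lee_addgt0Pr => e e0.
have [a Aa ltAa] := sup_adherent e0 supA.
have [b Bb ltBb] := inf_adherent e0 infB.
pose E1 := [set z : RT | A (s^-1 * (z - (1 - s) * b))%R].
pose E2 := [set z : RT | B ((1 - s)^-1 * (z - s * a))%R].
pose p := (s * a + (1 - s) * inf B)%R.
pose q := (s * sup A + (1 - s) * b)%R.
have mE1 : measurable E1 by exact: measurable_affine_preimage.
have mE2 : measurable E2 by exact: measurable_affine_preimage.
have E1C : E1 `<=` C.
  move=> z Az; have := ABC _ _ Az Bb; congr C; field; exact: lt0r_neq0.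
have E2C : E2 `<=` C.
  move=> z Bz; have := ABC _ _ Aa Bz; congr C; field; exact: lt0r_neq0.
have E1q z : E1 z -> (z <= q)%R.
  move=> /(ub_le_sup supA.2); rewrite mulrC ler_pdivrMr// /q => ?; lra.
have E2p z : E2 z -> (p <= z)%R.
  move=> /(ge_inf infB.2); rewrite mulrC ler_pdivlMr// /p => ?; lra.
rewrite -(@lebesgue_measure_affine s ((1 - s) * b) A)//.
rewrite -(@lebesgue_measure_affine (1 - s) (s * a) B)// -/E1 -/E2.
have mpq : measurable ([set` `[p, q]%R] : set RT) by exact: measurable_itv.
rewrite (measureDI lebesgue_measure mE1 mpq).
have -> : lam (E1 `\` [set` `[p, q]%R]) + lam (E1 `&` [set` `[p, q]%R]) + lam E2
  = (lam (E1 `\` [set` `[p, q]%R]) + lam E2) + lam (E1 `&` [set` `[p, q]%R]).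
  by rewrite -!addeA; congr (_ + _); rewrite addeC.
apply: leeD.
  rewrite -measureU//; first (apply: le_measure; rewrite ?inE//).
  - by apply: measurableU => //; exact: measurableD.
  - by move=> z [[/E1C]|/E2C].
  - exact: measurableD.
  - apply/seteqP; split => // z [[/E1q zq npq] /E2p zp]; apply: npq => /=.
    by rewrite in_itv/= zp zq.
apply: (@le_trans _ _ (lam [set` `[p, q]%R])).
  by apply: le_measure; rewrite ?inE//; exact: measurableI.
have qp : (q - p <= e)%R.
  rewrite /p /q.
  have : (0 <= s * (a - (sup A - e)))%R by rewrite mulr_ge0// ?ltW// subr_gt0.
  have : (0 <= (1 - s) * (inf B + e - b))%R by rewrite mulr_ge0// ?ltW// subr_gt0.
  move=> ? ?; lra.
rewrite lebesgue_measure_itv/=; case: ifPn => _; last by rewrite lee_fin ltW.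
by rewrite -EFinB lee_fin.
Qed.

Lemma brunn_minkowski_line (s : R) (A B C : set RT) : (0 < s < 1)%R ->
  measurable A -> measurable B -> measurable C ->
  A !=set0 -> B !=set0 ->
  (forall a b, A a -> B b -> C (s * a + (1 - s) * b)%R) ->
  s%:E * lam A + (1 - s)%:E * lam B <= lam C.
Proof.
move=> s01 mA mB mC [a Aa] [b Bb] ABC; have /andP[s0 s1] := s01.
pose I k : set RT := [set` `[- k%:R, k%:R]%R].
have mI k : measurable (I k) by exact: measurable_itv.
have ndI k l : (k <= l)%N -> I k `<=` I l.
  move=> kl x; rewrite /I /= !in_itv/= => /andP[h1 h2].
  have kl' : (k%:R <= l%:R :> R)%R by rewrite ler_nat.
  by apply/andP; split; lra.
have inI (x : R) : \forall k \near \oo, I k x.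
  have [K xK] : exists K : nat, (`|x| <= K%:R)%R.
    exists (Num.truncn `|x|).+1; apply: ltW; exact: truncnS_gt.
  exists K => // k /= Kk; rewrite /I /= in_itv/= -ler_norml (le_trans xK)//.
  by rewrite ler_nat.
have cvgI (D : set RT) : measurable D -> lam (D `&` I k) @[k --> \oo] --> lam D.
  move=> mD.
  have UI : \bigcup_k (D `&` I k) = D.
    apply/seteqP; split => x; first by move=> [k _ []].
    by move=> Dx; have [K _ /(_ K (leqnn _)) IK] := inI x; exists K.
  rewrite -{2}UI; apply: nondecreasing_cvg_mu.
  - by move=> k; exact: measurableI.
  - by rewrite UI.
  - move=> k l kl; apply/subsetPset; apply: setIS. exact: ndI.
have cv : s%:E * lam (A `&` I k) + (1 - s)%:E * lam (B `&` I k) @[k --> \oo]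
    --> s%:E * lam A + (1 - s)%:E * lam B.
  apply: cvgeD; last 2 first.
  - by apply: cvgeZl => //; exact: cvgI.
  - by apply: cvgeZl => //; exact: cvgI.
  - by apply: ge0_adde_def; rewrite inE mule_ge0// lee_fin ?subr_ge0 ltW.
apply: (cvge_le _ cv); near=> k.
apply: (@bounded_brunn_minkowski s k%:R) => //; try exact: measurableI.
- by exists a; split => //; near: k; exact: inI.
- by exists b; split => //; near: k; exact: inI.
- by move=> x y [Ax _] [By _]; exact: ABC.
Unshelve. all: by end_near. Qed.

End line.

(** * Integration over level sets *)

Section layer_cake.
Context {R : realType}.
Local Notation RT := (measurableTypeR R).
Local Notation lam := (@lebesgue_measure R).
Variable F : RT -> \bar R.
Hypotheses (mF : measurable_fun [set: RT] F) (F0 : forall x, 0 <= F x).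

Let S : set (RT * RT) := [set p | (0 < p.2 < 1)%R /\ p.2%:E < F p.1].

Let mS : measurable S.
Proof.
have -> : S = ([set: RT] `*` [set` `]0, 1[%R]) `&`
    ([set: RT * RT] `&` [set p | 0 < F p.1 - p.2%:E]).
  apply/seteqP; split => -[x l]; rewrite /S/= in_itv/= EFinN sube_gt0.
    by move=> [].
  by move=> [[_ ?] [_ ?]].
apply: measurableI; first by apply: measurableX => //; exact: measurable_itv.
apply: emeasurable_fun_o_infty => //; apply: emeasurable_funB.
  exact: measurableT_comp mF measurable_fst.
by apply/measurable_EFinP; exact: measurable_snd.
Qed.

Let levelE (l : R) : (0 < l < 1)%R ->
  \int[lam]_x (\1_S (x, l))%:E = lam [set x | l%:E < F x].
Proof.
move=> l01; pose A := [set x | l%:E < F x].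
rewrite (_ : (fun x => _) = fun x => (\1_A x)%:E).
  rewrite integral_indic// ?setIT// -[X in measurable X]setTI.
  exact: emeasurable_fun_o_infty.
by apply/funext => x; rewrite !indicE; congr (_ _)%:R%:E; apply/idP/idP;
  rewrite !inE /A /S/=; [case|].
Qed.

Let mlevel : measurable_fun [set: RT] (fun l => \int[lam]_x (\1_S (x, l))%:E).
Proof.
apply: (measurable_fun_fubini_tonelli_G (fun p => (\1_S p)%:E)) => //=.
by apply/measurable_EFinP; exact: measurable_indic.
Qed.

Lemma measurable_fun_level :
  measurable_fun (`]0%R, 1%R[%classic : set RT) (fun l : R => lam [set x | l%:E < F x]).
Proof.
apply: (@eq_measurable_fun _ _ _ _ _ (fun l => \int[lam]_x (\1_S (x, l))%:E)).
  by move=> l; rewrite inE/= in_itv/= => /levelE.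
exact: measurable_funTS.
Qed.

(** Both sides compute, by Tonelli, the area of the region under the graph of F
    between the heights 0 and 1.  Stopping at height 1 is what the one-dimensional
    inequality needs: above that level one of the level sets may be empty. *)
Lemma layer_cake : \int[lam]_x mine (F x) 1 =
  \int[lam]_(l in `]0%R, 1%R[) lam [set x | l%:E < F x].
Proof.
transitivity (\int[lam]_x \int[lam]_l (\1_S (x, l))%:E).
  apply: eq_integral => x _.
  rewrite (_ : (fun l => _) = fun l => (\1_[set l | S (x, l)] l)%:E); last first.
    by apply/funext => l; rewrite !indicE; congr (_ _)%:R%:E; apply/idP/idP;
      rewrite !inE.
  have [m [mE m0 m1 lm]] : exists m : R, [/\ mine (F x) 1 = m%:E,
      (0 <= m)%R, (m <= 1)%R &
      forall l, (0 < l < 1)%R -> (l%:E < F x) = (l < m)%R].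
    case: (F x) (F0 x) => [r| |]//= r0.
      exists (Num.min r 1%R); split; rewrite ?EFin_min ?ge_min ?lexx ?orbT//.
        by rewrite le_min -lee_fin r0 ler01.
      by move=> l /andP[_ l1]; rewrite lt_min l1 andbT lte_fin.
    exists 1%R; split => //.
    by move=> l /andP[_ l1]; rewrite l1 ltry.
  have -> : [set l | S (x, l)] = `]0%R, m[%classic.
    apply/seteqP; split => l; rewrite /S/= in_itv/=.
      by move=> [l01]; rewrite lm//; move/andP: l01 => [-> _].
    move=> /andP[l0 ltm]; have l01 : (0 < l < 1)%R by rewrite l0 (lt_le_trans ltm).
    by rewrite lm.
  rewrite integral_indic//.
  rewrite setIT/= lebesgue_measure_itv/= mE lte_fin.
  by move: m0; rewrite le_eqVlt => /predU1P[<-|->]; rewrite ?ltxx ?sube0.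
rewrite (fubini_tonelli (fun p => (\1_S p)%:E)) //=; last first.
  by apply/measurable_EFinP; exact: measurable_indic.
rewrite [RHS]integral_mkcond; apply: eq_integral => l _.
rewrite patchE; case: ifPn => [|l01]; first by rewrite inE/= in_itv/= => /levelE.
rewrite integral0_eq// => x _; rewrite indicE memNset// /S/= => -[l01' _].
by move: l01; rewrite notin_setE/= in_itv/= l01'.
Qed.

End layer_cake.

(** * The Prekopa-Leindler inequality on the line *)

Section prekopa_line.
Context {R : realType}.
Local Notation RT := (measurableTypeR R).
Local Notation lam := (@lebesgue_measure R).

(** For 0 < l < 1 the level sets of u and v at height l are nonempty, because both
    suprema are 1, and their weighted Minkowski sum lies in the level set of h.
    Integrating the resulting bound on measures over l gives the claim. *)
Lemma prekopa_leindler_line_normalized (s : R) (u v h : RT -> \bar R) :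
  (0 < s < 1)%R ->
  measurable_fun [set: RT] u -> measurable_fun [set: RT] v ->
  measurable_fun [set: RT] h ->
  (forall x, 0 <= u x <= 1) -> (forall x, 0 <= v x <= 1) ->
  (forall x, 0 <= h x) ->
  (forall l : R, (l < 1)%R -> exists x, l%:E < u x) ->
  (forall l : R, (l < 1)%R -> exists x, l%:E < v x) ->
  (forall x y, mine (u x) (v y) <= h (s * x + (1 - s) * y)%R) ->
  s%:E * \int[lam]_x u x + (1 - s)%:E * \int[lam]_x v x <= \int[lam]_x h x.
Proof.
move=> s01 mu mv mh u01 v01 h0 supu supv uvh.
have /andP[s0 s1] := s01.
have u0 x : 0 <= u x by have /andP[] := u01 x.
have v0 x : 0 <= v x by have /andP[] := v01 x.
have mI : measurable (`]0%R, 1%R[%classic : set RT) by exact: measurable_itv.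
have lc w : measurable_fun [set: RT] w -> (forall x, 0 <= w x <= 1) ->
    \int[lam]_x w x = \int[lam]_(l in `]0%R, 1%R[) lam [set x | l%:E < w x].
  move=> mw w01; rewrite -layer_cake//; last by move=> x; have /andP[] := w01 x.
  by apply: eq_integral => x _; rewrite min_l//; have /andP[] := w01 x.
have mlevel (w : RT -> \bar R) l : measurable_fun [set: RT] w ->
    measurable [set x | l%:E < w x].
  by move=> mw; rewrite -[X in measurable X]setTI; exact: emeasurable_fun_o_infty.
pose U (w : RT -> \bar R) (l : R) := lam [set x | l%:E < w x].
have mU w : measurable_fun [set: RT] w -> (forall x, 0 <= w x) ->
    measurable_fun (`]0%R, 1%R[%classic : set RT) (U w).
  by move=> *; exact: measurable_fun_level.
have -> : s%:E * \int[lam]_x u x + (1 - s)%:E * \int[lam]_x v x =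
    \int[lam]_(l in `]0%R, 1%R[) (s%:E * U u l + (1 - s)%:E * U v l).
  rewrite ge0_integralD//.
  - rewrite !ge0_integralZl// ?lc//; try exact: mU.
      by rewrite lee_fin subr_ge0 ltW.
    by rewrite lee_fin ltW.
  - by move=> l _; rewrite mule_ge0// lee_fin ltW.
  - by apply: measurable_funeM; exact: mU.
  - by move=> l _; rewrite mule_ge0// lee_fin subr_ge0 ltW.
  - by apply: measurable_funeM; exact: mU.
apply: (@le_trans _ _ (\int[lam]_x mine (h x) 1)); last first.
  apply: ge0_le_integral => //.
  - by move=> x _; rewrite le_min h0 lee01.
  - by apply: measurable_mine => //; exact: measurable_cst.
  - by move=> x _; rewrite ge_min lexx.
rewrite layer_cake//; apply: ge0_le_integral => //.
- by move=> l _; rewrite adde_ge0// mule_ge0// lee_fin ?subr_ge0 ltW.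
- by apply: emeasurable_funD; apply: measurable_funeM; exact: mU.
- exact: measurable_fun_level.
move=> l /=; rewrite in_itv/= => /andP[l0 l1].
apply: brunn_minkowski_line => //; try exact: mlevel.
- exact: supu.
- exact: supv.
move=> x y /= lx ly; apply: lt_le_trans (uvh x y).
by rewrite lt_min lx ly.
Qed.

(** Let M and N be the suprema of u and v.  Then u / M, v / N and h / sqrt (M N)
    satisfy the normalized hypotheses, so with U, V, H the three integrals
    s U / M + (1 - s) V / N <= H / sqrt (M N); squaring and
    (x + y)^2 >= 4 x y give the product form, in which M and N cancel. *)
Lemma prekopa_leindler_line_bounded (s K : R) (u v h : RT -> \bar R) :
  (0 < s < 1)%R ->
  measurable_fun [set: RT] u -> measurable_fun [set: RT] v ->
  measurable_fun [set: RT] h ->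
  (forall x, 0 <= u x <= K%:E) -> (forall x, 0 <= v x <= K%:E) ->
  (forall x, 0 <= h x) ->
  (forall x y, u x * v y <= h (s * x + (1 - s) * y)%R * h (s * x + (1 - s) * y)%R) ->
  (4 * s * (1 - s))%:E * (\int[lam]_x u x * \int[lam]_x v x) <=
  \int[lam]_x h x * \int[lam]_x h x.
Proof.
move=> s01 mu mv mh u0K v0K h0 uvh; have /andP[s0 s1] := s01.
have u0 x : 0 <= u x by have /andP[] := u0K x.
have v0 x : 0 <= v x by have /andP[] := v0K x.
have H0 : 0 <= \int[lam]_x h x by exact: integral_ge0.
have supE w : (forall x, 0 <= w x <= K%:E) ->
    \int[lam]_x w x = 0 \/ exists M : R, [/\ (0 < M)%R, forall x, w x <= M%:E &
     forall l : R, (l < 1)%R -> exists x, (l * M)%:E < w x].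
  move=> w0K; pose S := ereal_sup (range w).
  have wS x : w x <= S by apply: ereal_sup_ubound; exists x.
  have S0 : 0 <= S by apply: le_trans (wS 0%R); have /andP[] := w0K 0%R.
  have SK : S <= K%:E by apply: ge_ereal_sup => _ [x _ <-]; have /andP[] := w0K x.
  have SE : S = (fine S)%:E.
    by rewrite fineK// ge0_fin_numE// (le_lt_trans SK)// ltry.
  move: S0; rewrite le_eqVlt => /predU1P[S0|S0].
    left; rewrite integral0_eq// => x _; apply/eqP; rewrite eq_le {1}S0 wS/=.
    by have /andP[] := w0K x.
  right; exists (fine S); split; first by rewrite -lte_fin -SE.
    by move=> x; rewrite -SE.
  move=> l l1; have : (l * fine S)%:E < S.
    by rewrite {2}SE lte_fin gtr_pMl// -lte_fin -SE.
  by move=> /ereal_sup_gt[_ [x _ <-] lx]; exists x.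
have [->|[M [M0 uM supu]]] := supE _ u0K; first by rewrite mul0e mule0 mule_ge0.
have [->|[N [N0 vN supv]]] := supE _ v0K; first by rewrite !mule0 mule_ge0.
pose q := Num.sqrt (M * N).
have MN0 : (0 < M * N)%R by rewrite mulr_gt0.
have q0 : (0 < q)%R by rewrite sqrtr_gt0.
have qq : (q * q = M * N)%R by rewrite -expr2 sqr_sqrtr// ltW.
have scale (w : RT -> \bar R) c : (0 < c)%R -> (forall x, 0 <= w x) ->
    measurable_fun [set: RT] w ->
    \int[lam]_x (c^-1%:E * w x) = c^-1%:E * \int[lam]_x w x.
  by move=> c0 w0 mw; rewrite ge0_integralZl// lee_fin invr_ge0 ltW.
have norm01 (w : RT -> \bar R) c : (0 < c)%R -> (forall x, 0 <= w x <= K%:E) ->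
    (forall x, w x <= c%:E) -> forall x, 0 <= c^-1%:E * w x <= 1.
  move=> c0 w0 wc x; rewrite mule_ge0 ?lee_fin ?invr_ge0 ?(ltW c0)//=; last first.
    by have /andP[] := w0 x.
  by rewrite muleC lee_pdivrMr// mul1e.
have normsup (w : RT -> \bar R) c : (0 < c)%R ->
    (forall l : R, (l < 1)%R -> exists x, (l * c)%:E < w x) ->
    forall l : R, (l < 1)%R -> exists x, l%:E < c^-1%:E * w x.
  move=> c0 wc l /wc[x lx]; exists x.
  by rewrite muleC lte_pdivlMr// -EFinM.
have key : s%:E * (M^-1%:E * \int[lam]_x u x)
    + (1 - s)%:E * (N^-1%:E * \int[lam]_x v x) <= q^-1%:E * \int[lam]_x h x.
  rewrite -!scale//; apply: prekopa_leindler_line_normalized => //.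
  - exact: measurable_funeM.
  - exact: measurable_funeM.
  - exact: measurable_funeM.
  - exact: norm01.
  - exact: norm01.
  - by move=> x; rewrite mule_ge0// lee_fin invr_ge0 ltW.
  - exact: normsup.
  - exact: normsup.
  move=> x y; have := uvh x y; set z := (s * x + _)%R.
  have uf : u x = (fine (u x))%:E.
    by rewrite fineK// ge0_fin_numE// (le_lt_trans (uM x))// ltry.
  have vf : v y = (fine (v y))%:E.
    by rewrite fineK// ge0_fin_numE// (le_lt_trans (vN y))// ltry.
  have := h0 z; have := u0 x; have := v0 y; rewrite uf vf.
  case: (h z) => [r| |]//; last first.
    by move=> *; rewrite gt0_muley ?leey// lte_fin invr_gt0.
  rewrite -!EFinM -EFin_min !lee_fin => b0 a0 r0 abr.
  rewrite leNgt lt_min; apply/negP => /andP[h1 h2].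
  have qr0 : (0 <= q^-1 * r)%R by rewrite mulr_ge0// invr_ge0 ltW.
  have := ltr_pM qr0 qr0 h1 h2; apply/negP; rewrite -leNgt.
  have -> : (M^-1 * fine (u x) * (N^-1 * fine (v y)) = (fine (u x) * fine (v y)) / (M * N))%R.
    by field; rewrite !gt_eqF.
  have -> : (q^-1 * r * (q^-1 * r) = (r * r) / (q * q))%R by field; rewrite gt_eqF.
  by rewrite qq ler_pM2r// invr_gt0.
have pmy (c : R) : (0 < c)%R -> c%:E * +oo = +oo.
  by move=> c0; rewrite gt0_muley// lte_fin.
have sM : s%:E * (M^-1%:E * +oo) = +oo by rewrite !pmy ?invr_gt0.
have sN : (1 - s)%:E * (N^-1%:E * +oo) = +oo by rewrite !pmy ?invr_gt0 ?subr_gt0.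
move: key H0.
have : 0 <= \int[lam]_x u x by exact: integral_ge0.
have : 0 <= \int[lam]_x v x by exact: integral_ge0.
(* An infinite integral of h makes the claim trivial; a finite one forces, by
   key, the integrals of u and v to be finite. *)
case: (\int[lam]_x h x) => [c| |]//; last by move=> *; rewrite mulyy leey.
case: (\int[lam]_x u x) => [a| |]//; case: (\int[lam]_x v x) => [b| |]// b0 a0.
- rewrite -!EFinM -EFinD !lee_fin => key c0.
  pose x := (s * (M^-1 * a))%R; pose y := ((1 - s) * (N^-1 * b))%R.
  have xy2 : (4 * (x * y) <= (q^-1 * c) ^+ 2)%R.
    apply: (@le_trans _ _ ((x + y) ^+ 2)%R).
      by have := sqr_ge0 (x - y)%R; lra.
    rewrite ler_sqr// nnegrE; last by rewrite mulr_ge0// invr_ge0 ltW.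
    by rewrite addr_ge0// !mulr_ge0// ?invr_ge0 ?subr_ge0 ltW.
  have -> : (4 * s * (1 - s) * (a * b) = (M * N) * (4 * (x * y)))%R.
    by rewrite /x /y; field; rewrite !gt_eqF.
  have -> : (c * c = (M * N) * (q^-1 * c) ^+ 2)%R.
    by rewrite -qq; field; rewrite gt_eqF.
  by rewrite ler_pM2l.
- by rewrite sN -!EFinM addey// leye_eq.
- by rewrite sM -!EFinM addye// leye_eq.
- by rewrite sM sN addye// leye_eq.
Qed.

End prekopa_line.

Section prekopa_line_unbounded.
Context {R : realType}.
Local Notation RT := (measurableTypeR R).
Local Notation lam := (@lebesgue_measure R).

Lemma cvg_mine_nat (x : \bar R) : mine x k%:R%:E @[k --> \oo] --> x.
Proof.
case: x => [r| |].
- apply: cvg_near_cst; exists (Num.truncn r).+1 => // k /= rk.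
  rewrite min_l// lee_fin (le_trans (ltW (truncnS_gt _)))// ler_nat//.
- by under eq_fun do rewrite min_r ?leey//; exact/cvgenyP.
- by under eq_fun do rewrite min_l ?leNye//; exact: cvg_cst.
Qed.

(** The zero cases are split off because multiplication is discontinuous at
    0 * +oo, where however the claim is trivial. *)
Lemma cvg_mule_le (a b C : \bar R) (u v : nat -> \bar R) :
  0 <= a -> 0 <= b -> 0 <= C ->
  u k @[k --> \oo] --> a -> v k @[k --> \oo] --> b ->
  (forall k, u k * v k <= C) -> a * b <= C.
Proof.
move=> a0 b0 C0 ua vb uvC.
have [->|aN0] := eqVneq a 0; first by rewrite mul0e.
have [->|bN0] := eqVneq b 0; first by rewrite mule0.
apply: (cvge_le _ (cvgeM _ ua vb)); first exact: nearW.
by apply: neq0_mule_def; rewrite mule_neq0.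
Qed.

(** The hypothesis survives truncation of u and v at height k, so monotone
    convergence reduces the general case to the bounded one. *)
Lemma prekopa_leindler_line (s : R) (u v h : RT -> \bar R) :
  (0 < s < 1)%R ->
  measurable_fun [set: RT] u -> measurable_fun [set: RT] v ->
  measurable_fun [set: RT] h ->
  (forall x, 0 <= u x) -> (forall x, 0 <= v x) -> (forall x, 0 <= h x) ->
  (forall x y, u x * v y <= h (s * x + (1 - s) * y)%R * h (s * x + (1 - s) * y)%R) ->
  (4 * s * (1 - s))%:E * (\int[lam]_x u x * \int[lam]_x v x) <=
  \int[lam]_x h x * \int[lam]_x h x.
Proof.
move=> s01 mu mv mh u0 v0 h0 uvh; have /andP[s0 s1] := s01.
have c0 : (0 < 4 * s * (1 - s))%R by rewrite !mulr_gt0 ?subr_gt0.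
have mtr (w : RT -> \bar R) (k : nat) : measurable_fun [set: RT] w ->
    measurable_fun [set: RT] (fun x => mine (w x) k%:R%:E).
  by move=> mw; apply: measurable_mine => //; exact: measurable_cst.
have tr0 (w : RT -> \bar R) (k : nat) x : 0 <= w x -> 0 <= mine (w x) k%:R%:E.
  by move=> wx; rewrite le_min wx/= lee_fin ler0n.
have cvgtr (w : RT -> \bar R) : measurable_fun [set: RT] w -> (forall x, 0 <= w x) ->
    \int[lam]_x mine (w x) k%:R%:E @[k --> \oo] --> \int[lam]_x w x.
  move=> mw w0.
  rewrite [X in _ --> X](_ : _ = \int[lam]_x limn (fun k => mine (w x) k%:R%:E)).
    apply: cvg_monotone_convergence => //.
    - by move=> k; exact: mtr.
    - by move=> k x _; exact: tr0.
    - move=> x _ k l kl; rewrite le_min !ge_min lexx/=.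
      by rewrite lee_fin ler_nat kl orbT.
  by apply: eq_integral => x _; apply/esym/cvg_lim => //; exact: cvg_mine_nat.
have truv (w : RT -> \bar R) (k : nat) x : 0 <= w x -> 0 <= mine (w x) k%:R%:E <= k%:R%:E.
  by move=> wx; rewrite tr0//= ge_min lexx orbT.
rewrite muleA; apply: (cvg_mule_le _ _ _ _ (cvgtr v mv v0)).
- by apply: mule_ge0; [rewrite lee_fin ltW|exact: integral_ge0].
- exact: integral_ge0.
- by apply: mule_ge0; exact: integral_ge0.
- by apply: cvgeZl => //; exact: (cvgtr u).
move=> k; rewrite -muleA.
apply: (@prekopa_leindler_line_bounded _ s k%:R) => //; try exact: mtr.
- by move=> x; exact: truv.
- by move=> x; exact: truv.
move=> x y; apply: le_trans (uvh x y).
by apply: lee_pmul; rewrite ?tr0// ge_min lexx.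
Qed.

End prekopa_line_unbounded.

(** * The Prekopa-Leindler inequality in R^n *)

Section induction.
Context {R : realType}.
Local Notation RT := (measurableTypeR R).
Local Notation lam := (@lebesgue_measure R).

Lemma integral_lebesgue_tupleS n (w : n.+1.-tuple RT -> \bar R) :
  measurable_fun [set: n.+1.-tuple RT] w -> (forall x, 0 <= w x) ->
  \int[lebesgue_measure_tuple]_x w x =
  \int[lam]_a \int[lebesgue_measure_tuple]_y w (tuple_of_pair (a, y)).
Proof.
move=> mw w0.
rewrite [LHS](_ : _ = \int[pushforward (lam \x @lebesgue_measure_tuple R n)
  (@tuple_of_pair R n)]_x w x)//.
rewrite ge0_integral_pushforward//; last exact: measurable_tuple_of_pair.
rewrite preimage_setT (fubini_tonelli1 (w \o @tuple_of_pair R n))//.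
  by apply: measurableT_comp => //; exact: measurable_tuple_of_pair.
by move=> x; exact: w0.
Qed.

Lemma measurable_section_tupleS n (w : n.+1.-tuple RT -> \bar R) (a : RT) :
  measurable_fun [set: n.+1.-tuple RT] w ->
  measurable_fun [set: n.-tuple RT] (fun y => w (tuple_of_pair (a, y))).
Proof.
move=> mw; apply: (measurableT_comp (f := w \o @tuple_of_pair R n)) => //.
by apply: measurableT_comp => //; exact: measurable_tuple_of_pair.
Qed.

Lemma measurable_integral_tupleS n (w : n.+1.-tuple RT -> \bar R) :
  measurable_fun [set: n.+1.-tuple RT] w -> (forall x, 0 <= w x) ->
  measurable_fun [set: RT]
    (fun a => \int[lebesgue_measure_tuple]_y w (tuple_of_pair (a, y))).
Proof.
move=> mw w0.
apply: (measurable_fun_fubini_tonelli_F (w \o @tuple_of_pair R n)) => //=.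
by apply: measurableT_comp => //; exact: measurable_tuple_of_pair.
Qed.

Lemma tuple_conv_tuple_of_pair n (s : R) (a b : RT) (x y : n.-tuple RT) :
  tuple_conv s (tuple_of_pair (a, x)) (tuple_of_pair (b, y)) =
  tuple_of_pair ((s * a + (1 - s) * b)%R, tuple_conv s x y).
Proof.
apply: eq_from_tnth => i; rewrite tnth_mktuple.
case: (unliftP ord0 i) => [j ->|->]; last by rewrite !tnth0.
by rewrite !tnthS tnth_mktuple.
Qed.

(** With points weighted s, 1 - s but both functions entering with exponent 1/2,
    each coordinate contributes a factor 4 s (1 - s) <= 1; for s = 1/2 this is the
    usual midpoint inequality.  In the induction step the sections over first
    coordinates a, b and s a + (1 - s) b satisfy the hypothesis in dimension n, so
    the partial integrals satisfy it, up to the constant, on the line. *)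
Lemma prekopa_leindler n (s : R) (u v h : n.-tuple RT -> \bar R) :
  (0 < s < 1)%R ->
  measurable_fun [set: n.-tuple RT] u -> measurable_fun [set: n.-tuple RT] v ->
  measurable_fun [set: n.-tuple RT] h ->
  (forall x, 0 <= u x) -> (forall x, 0 <= v x) -> (forall x, 0 <= h x) ->
  (forall x y, u x * v y <= h (tuple_conv s x y) * h (tuple_conv s x y)) ->
  ((4 * s * (1 - s)) ^+ n)%:E *
    (\int[lebesgue_measure_tuple]_x u x * \int[lebesgue_measure_tuple]_x v x) <=
  \int[lebesgue_measure_tuple]_x h x * \int[lebesgue_measure_tuple]_x h x.
Proof.
move=> s01; have /andP[s0 s1] := s01.
have c0 : (0 < 4 * s * (1 - s))%R by rewrite !mulr_gt0 ?subr_gt0.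
elim: n u v h => [|n IH] u v h mu mv mh u0 v0 h0 uvh.
  rewrite expr0 mul1e /= !integral_dirac// !diracT !mul1e.
  by have := uvh [tuple] [tuple]; rewrite (tuple0 (tuple_conv _ _ _)).
set c := (4 * s * (1 - s))%R in c0 *.
rewrite !integral_lebesgue_tupleS//.
set U := fun a => \int[_]_y u _.
set V := fun a => \int[_]_y v _.
set H := fun a => \int[_]_y h _.
have U0 a : 0 <= U a by apply: integral_ge0.
have V0 a : 0 <= V a by apply: integral_ge0.
have H0 a : 0 <= H a by apply: integral_ge0.
have mU : measurable_fun [set: RT] U by exact: measurable_integral_tupleS.
have mV : measurable_fun [set: RT] V by exact: measurable_integral_tupleS.
have mH : measurable_fun [set: RT] H by exact: measurable_integral_tupleS.
have cn0 : 0 <= (c ^+ n)%:E by rewrite lee_fin exprn_ge0// ltW.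
have cU : (c ^+ n)%:E * \int[lam]_x U x = \int[lam]_x ((c ^+ n)%:E * U x).
  by rewrite ge0_integralZl.
rewrite exprS EFinM -muleA [X in _ * X]muleA cU.
apply: prekopa_leindler_line => //.
- exact: measurable_funeM.
- by move=> a; exact: mule_ge0.
move=> a b; rewrite -muleA; apply: IH => //.
- exact: measurable_section_tupleS.
- exact: measurable_section_tupleS.
- exact: measurable_section_tupleS.
by move=> x y; rewrite -tuple_conv_tuple_of_pair.
Qed.

End induction.

(** * Integration against a density *)

Section density.
Context {R : realType} d (T : measurableType d).
Variables (mu nu : {measure set T -> \bar R}) (f : T -> R).
Hypotheses (mf : measurable_fun [set: T] f) (f0 : forall x, (0 <= f x)%R).
Hypothesis nuE : forall A, measurable A -> nu A = \int[mu]_(x in A) (f x)%:E.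

Import HBNNSimple.

Lemma integral_density_nnsfun (h : {nnsfun T >-> R}) :
  \int[nu]_x (h x)%:E = \int[mu]_x ((h x)%:E * (f x)%:E).
Proof.
have mEf : measurable_fun [set: T] (EFin \o f) by exact/measurable_EFinP.
rewrite integralT_nnsfun sintegralE.
transitivity (\int[mu]_x (\sum_(y \in range h)
    ((y * \1_(h @^-1` [set y]) x)%:E * (f x)%:E))); last first.
  apply: eq_integral => x _; rewrite -ge0_mule_fsuml => [|y].
    by rewrite fsumEFin// -fimfunE.
  exact: nnfun_muleindic_ge0.
rewrite ge0_integral_fsum//; last 2 first.
- move=> y; apply: emeasurable_funM => //.
  by apply/measurable_EFinP; apply: measurable_funM.
- by move=> y x _; rewrite mule_ge0 ?lee_fin//; exact: nnfun_muleindic_ge0.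
apply: eq_fsbigr => r; rewrite inE => -[t _ <-].
under eq_integral do rewrite EFinM -muleA.
have mind : measurable_fun [set: T]
    (fun x => (\1_(h @^-1` [set h t]) x)%:E * (f x)%:E).
  by apply: emeasurable_funM => //; exact/measurable_EFinP.
rewrite ge0_integralZl//; last 2 first.
- by move=> x _; rewrite mule_ge0 ?lee_fin.
- by rewrite lee_fin.
rewrite nuE// [in LHS]integral_mkcond; congr (_ * _).
apply: eq_integral => x _; rewrite patchE indicE.
by case: ifPn => _; rewrite ?mul1e ?mul0e.
Qed.

Lemma integral_density (g : T -> \bar R) : measurable_fun [set: T] g ->
  (forall x, 0 <= g x) ->
  \int[nu]_x g x = \int[mu]_x (g x * (f x)%:E).
Proof.
move=> mg g0; pose h := nnsfun_approx measurableT mg.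
have mEf : measurable_fun [set: T] (EFin \o f) by exact/measurable_EFinP.
have hg x : (h k x)%:E @[k --> \oo] --> g x by exact: cvg_nnsfun_approx.
transitivity (limn (fun k => \int[nu]_x (h k x)%:E)).
  rewrite -monotone_convergence//.
  - by apply: eq_integral => x _; apply/esym/cvg_lim.
  - by move=> k; exact/measurable_EFinP.
  - by move=> k x _; rewrite lee_fin.
  - by move=> x _ k l kl; rewrite lee_fin; exact/lefP/nd_nnsfun_approx.
transitivity (limn (fun k => \int[mu]_x ((h k x)%:E * (f x)%:E))).
  by congr (limn _); apply/funext => k; exact: integral_density_nnsfun.
rewrite -monotone_convergence//.
- apply: eq_integral => x _; apply/cvg_lim => //.
  exact: cvgeZr.
- by move=> k; apply: emeasurable_funM => //; exact/measurable_EFinP.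
- by move=> k x _; rewrite mule_ge0 ?lee_fin.
- move=> x _ k l kl; rewrite lee_wpmul2r ?lee_fin//.
  exact/lefP/nd_nnsfun_approx.
Qed.

End density.

(** * Concentration from a pair of exponential moments *)

Section exponential_moments.
Context {R : realType} d (T : measurableType d) (P : probability T R).
Variables (L : T -> R) (b C : R).
Hypotheses (mL : measurable_fun [set: T] L) (b0 : (0 < b)%R) (C0 : (0 < C)%R).

Lemma measurable_expR_scale (k : R) :
  measurable_fun [set: T] (fun w => expR (k * L w)).
Proof.
by apply: measurableT_comp => //; exact: measurable_funM.
Qed.

Lemma measurable_deviation (r h : R) :
  measurable [set w | (r <= `|L w - h|)%R].
Proof.
have -> : [set w | (r <= `|L w - h|)%R] =
    [set: T] `&` [set w | r%:E <= `|L w - h|%:E].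
  by rewrite setTI; apply/seteqP; split => w; rewrite /= lee_fin.
apply: emeasurable_fun_c_infty => //; apply/measurable_EFinP.
by apply: measurableT_comp => //; exact: measurable_funB.
Qed.

Lemma exp_moment_gt0 (k : R) : 0 < \int[P]_w (expR (k * L w))%:E.
Proof.
have mE : measurable_fun [set: T] (fun w => (expR (k * L w))%:E).
  by apply/measurable_EFinP; exact: measurable_expR_scale.
rewrite lt0e integral_ge0 ?andbT; last by move=> w _; rewrite lee_fin expR_ge0.
apply/eqP => I0.
have : ae_eq P setT (fun w => (expR (k * L w))%:E) (cst 0).
  apply/ae_eq_integral_abs => //; rewrite -[RHS]I0; apply: eq_integral => w _.
  by rewrite gee0_abs// lee_fin expR_ge0.
move=> [N [mN N0 subN]].
have NT : N = setT.
  apply/seteqP; split => // w _; apply: subN => /= /(_ I) [] /eqP.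
  by rewrite gt_eqF// expR_gt0.
by have := probability_setT P; rewrite -NT N0 => /esym/eqP; rewrite onee_eq0.
Qed.

(** Jensen's inequality for the exponential: integrate the tangent line
    inequality e^(kL) >= e^(km) (1 + k (L - m)), where m is the mean of L. *)
Lemma expR_mean_le (k : R) : P.-integrable setT (EFin \o L) ->
  P.-integrable setT (fun w => (expR (k * L w))%:E) ->
  (expR (k * fine (\int[P]_w (L w)%:E)))%:E <= \int[P]_w (expR (k * L w))%:E.
Proof.
move=> iL iE; set m := fine _.
have mE : \int[P]_w (L w)%:E = m%:E by rewrite fineK//; exact: integrable_fin_num.
pose a := (expR (k * m))%R.
have i1 : P.-integrable setT (EFin \o cst (a * (1 - k * m))%R).
  exact: finite_measure_integrable_cst.
have i2 : P.-integrable setT (fun w => (a * k)%:E * (EFin \o L) w).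
  exact: integrableZl.
have -> : (expR (k * m))%:E =
    \int[P]_w ((a * (1 - k * m))%:E + (a * k)%:E * (L w)%:E).
  rewrite integralD//= integral_cst//= probability_setT mule1.
  rewrite integralZl// mE -EFinM -EFinD; congr EFin; rewrite -/a; ring.
apply: le_integral => //; first exact: integrableD.
move=> w _; rewrite -EFinM -EFinD lee_fin.
have -> : (k * L w = k * m + k * (L w - m))%R by ring.
rewrite expRD -/a; have := expR_ge1Dx (k * (L w - m))%R.
have a0 : (0 < a)%R by exact: expR_gt0.
move=> h.
have := ler_wpM2l (ltW a0) h; lra.
Qed.

Hypothesis CAB : C%:E * (\int[P]_w (expR (b * L w))%:E *
  \int[P]_w (expR (- b * L w))%:E) <= 1.

(** Each moment is positive, so an infinite one would make the product infinite. *)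
Lemma exp_moments_integrable :
  P.-integrable setT (fun w => (expR (b * L w))%:E) /\
  P.-integrable setT (fun w => (expR (- b * L w))%:E).
Proof.
have H k : \int[P]_w (expR (k * L w))%:E < +oo ->
    P.-integrable setT (fun w => (expR (k * L w))%:E).
  move=> Ioo; apply/integrableP; split.
    by apply/measurable_EFinP; exact: measurable_expR_scale.
  rewrite (eq_integral (fun w => (expR (k * L w))%:E))// => w _.
  by rewrite gee0_abs// lee_fin expR_ge0.
move: CAB (exp_moment_gt0 b) (exp_moment_gt0 (- b)).
have C0E : 0 < C%:E by rewrite lte_fin.
case A : (\int[P]_w (expR (b * L w))%:E) => [x| |]//;
  case B : (\int[P]_w (expR (- b * L w))%:E) => [y| |]// h x0 y0.
- by split; apply: H; rewrite ?A ?B ltry.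
- by move: h; rewrite gt0_muley// gt0_muley// leye_eq.
- by move: h; rewrite gt0_mulye// gt0_muley// leye_eq.
- by move: h; rewrite mulyy gt0_muley// leye_eq.
Qed.

(** Since 1 + t <= e^t, one has b |L| <= e^(bL) + e^(-bL). *)
Lemma exp_moments_integrable_fun : P.-integrable setT (EFin \o L).
Proof.
have [iA iB] := exp_moments_integrable.
have iG : P.-integrable setT (fun w =>
    b^-1%:E * ((expR (b * L w))%:E + (expR (- b * L w))%:E)).
  by apply: integrableZl => //; exact: integrableD.
apply: le_integrable iG => //; first exact/measurable_EFinP.
move=> w _ /=; rewrite lee_fin [leRHS]ger0_norm; last first.
  by rewrite mulr_ge0 ?invr_ge0 ?addr_ge0 ?expR_ge0 ?ltW.
rewrite mulrC ler_pdivlMr// mulrC -[X in (X * _)%R]gtr0_norm// -normrM.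
have h1 := expR_ge1Dx (b * L w); have h2 := expR_ge1Dx (- b * L w).
have p1 := expR_gt0 (b * L w); have p2 := expR_gt0 (- b * L w).
rewrite ler_norml; apply/andP; split; lra.
Qed.

(** Markov's inequality for e^(b(L-h)) + e^(-b(L-h)).  With x, y the moments of
    e^(bL), e^(-bL), Jensen gives e^(-bh) <= y and e^(bh) <= x, so each term has
    mean at most x y <= 1 / C. *)
Lemma exp_moments_concentration (r : R) (h := fine (\int[P]_w (L w)%:E)) :
  P [set w | (r <= `|L w - h|)%R] <= (2 / C * expR (- (b * r)))%:E.
Proof.
have [iA iB] := exp_moments_integrable.
have iL := exp_moments_integrable_fun.
have JA := expR_mean_le iL iA; have JB := expR_mean_le iL iB.
rewrite -/h in JA JB.
move: CAB JA JB.
set S := [set w | _].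
have mS : measurable S by exact: measurable_deviation.
have key : (expR (b * r))%:E * P S <=
    (expR (- b * h))%:E * \int[P]_w (expR (b * L w))%:E +
    (expR (b * h))%:E * \int[P]_w (expR (- b * L w))%:E.
  rewrite -!integralZl// -integralD//; try exact: integrableZl.
  pose G w := (expR (- b * h))%:E * (expR (b * L w))%:E +
    (expR (b * h))%:E * (expR (- b * L w))%:E.
  have mG : measurable_fun [set: T] G.
    by apply: emeasurable_funD; apply: measurable_funeM; apply/measurable_EFinP;
      exact: measurable_expR_scale.
  have G0 w : 0 <= G w by rewrite /G -!EFinM -EFinD lee_fin addr_ge0// mulr_ge0// expR_ge0.
  rewrite -integral_cst//; apply: (@le_trans _ _ (\int[P]_(w in S) G w)).
    apply: ge0_le_integral => //.
    - by move=> w _; rewrite lee_fin expR_ge0.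
    - exact: measurable_funTS.
    move=> w; rewrite /S /= => rw.
    rewrite /G -!EFinM -EFinD lee_fin -!expRD.
    apply: (@le_trans _ _ (expR (b * `|L w - h|))%R).
      by rewrite ler_expR ler_pM2l.
    case: (ger0P (L w - h)%R) => _.
      rewrite (_ : (b * (L w - h) = - b * h + b * L w)%R); last by ring.
      by rewrite lerDl expR_ge0.
    rewrite (_ : (b * - (L w - h) = b * h + - b * L w)%R); last by ring.
    by rewrite lerDr expR_ge0.
  exact: ge0_subset_integral.
move: key.
have := integrable_fin_num measurableT iA.
have := integrable_fin_num measurableT iB.
move: (\int[P]_w _) (\int[P]_w (expR (b * L w))%:E) => [y| |]// [x| |]// _ _.
have : P S \is a fin_num by exact: fin_num_measure.
case: (P S) => [p| |]// _.
rewrite -!EFinM -EFinD !lee_fin => key Cxy Jx Jy.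
rewrite expRN mulrC ler_pdivlMl ?expR_gt0//; apply: le_trans key _.
have x0 : (0 < x)%R by apply: lt_le_trans Jx; exact: expR_gt0.
have y0 : (0 < y)%R by apply: lt_le_trans Jy; exact: expR_gt0.
have xy : (x * y <= C^-1)%R by rewrite -(ler_pM2l C0) mulfV ?gt_eqF.
have h1 : (expR (- b * h) * x <= y * x)%R by rewrite ler_pM2r.
have h2 : (expR (b * h) * y <= x * y)%R by rewrite ler_pM2r.
lra.
Qed.

End exponential_moments.

(** * The information content of a log-concave density *)

Section log_concave_density.
Context {R : realType} (n : nat).
Local Notation RT := (measurableTypeR R).
Variable f : n.-tuple RT -> R.
Hypotheses (mf : measurable_fun [set: n.-tuple RT] f) (f0 : forall x, (0 <= f x)%R).

(** [prekopa_leindler] at s = (1 - b) / 2, so that 2 s = 1 - b and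
    2 (1 - s) = 1 + b are the two exponents. *)
Lemma log_concave_moments (b : R) : log_concave f -> (0 < b < 1)%R ->
  ((1 - b ^+ 2) ^+ n)%:E *
    (\int[lebesgue_measure_tuple]_x (f x `^ (1 - b))%:E *
     \int[lebesgue_measure_tuple]_x (f x `^ (1 + b))%:E) <=
  \int[lebesgue_measure_tuple]_x (f x)%:E * \int[lebesgue_measure_tuple]_x (f x)%:E.
Proof.
move=> lcf /andP[b0 b1]; pose s := ((1 - b) / 2)%R.
have s01 : (0 < s < 1)%R by rewrite /s; apply/andP; split; lra.
have -> : (1 - b ^+ 2 = 4 * s * (1 - s))%R by rewrite /s; field.
have mp p : measurable_fun [set: n.-tuple RT] (fun x => (f x `^ p)%:E).
  by apply/measurable_EFinP; exact: measurableT_comp (measurable_powR p) mf.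
apply: prekopa_leindler => //.
- exact/measurable_EFinP.
- by move=> x; rewrite lee_fin powR_ge0.
- by move=> x; rewrite lee_fin powR_ge0.
move=> x y; rewrite -!EFinM lee_fin.
have -> : (1 - b = s + s)%R by rewrite /s; field.
have -> : (1 + b = (1 - s) + (1 - s))%R by rewrite /s; field.
have dbl (a p : R) : (0 < p)%R -> (a `^ (p + p) = a `^ p * a `^ p)%R.
  by move=> p0; rewrite powRD// gt_eqF// addr_gt0.
have /andP[s0 s1] := s01.
rewrite !dbl ?subr_gt0// mulrACA; have := lcf x y s s01 => h.
by apply: ler_pM => //; apply: mulr_ge0; exact: powR_ge0.
Qed.

Context d (T : measurableType d) (P : probability T R).
Variable X : {RV P >-> n.-tuple RT}.
Hypothesis dens : is_density X f.

(** With L = - ln f(X), e^(kL) is f(X)^(-k), and integrating against the density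
    adds one to the exponent.  For k = 1 the claim fails when f vanishes on a set
    of positive measure, where f^0 = 1. *)
Lemma density_moment (k : R) : k != 1%R ->
  \int[P]_w (expR (k * - ln (f (X w))))%:E =
  \int[lebesgue_measure_tuple]_x (f x `^ (1 - k))%:E.
Proof.
move=> k1; have [_ _ Xf] := dens.
pose g x := (expR (k * - ln (f x)))%:E.
have mg : measurable_fun [set: n.-tuple RT] g.
  apply/measurable_EFinP; apply: measurableT_comp => //.
  apply: measurable_funM => //; apply: measurable_funN.
  exact: measurableT_comp.
have g0 x : 0 <= g x by rewrite lee_fin expR_ge0.
rewrite -[LHS](@ge0_integral_distribution _ _ _ _ _ P X g)//.
rewrite (integral_density mf f0 Xf)//.
apply: eq_integral => x _; rewrite /g -EFinM; congr EFin.
have [fx|fx] := eqVneq (f x) 0%R.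
  by rewrite fx mulr0 powR0// subr_eq0 eq_sym.
rewrite /powR (negbTE fx) -{2}[f x]lnK ?posrE ?lt0r ?fx ?f0//.
by rewrite -expRD; congr expR; ring.
Qed.

Lemma density_eq0 : P [set w | f (X w) = 0%R] = 0.
Proof.
have [_ _ Xf] := dens.
have mA : measurable [set x | f x = 0%R].
  by rewrite -[X in measurable X]setTI; exact: (mf _ (measurable_set1 0%R)).
rewrite -[LHS]/(distribution P X [set x | f x = 0%R]) Xf//.
by rewrite integral0_eq// => x /= ->.
Qed.

End log_concave_density.

(** From e^(2q) >= 1 + 2q with q = b^2, as (1 - q) (1 + 2q) >= 1 for
    0 <= q <= 1/2. *)
Lemma expR_le_1BX (R : realType) (b : R) : (0 < b <= 1 / 2)%R ->
  (expR (- (2 * b ^+ 2)) <= 1 - b ^+ 2)%R.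
Proof.
move=> /andP[b0 b1].
have bb : (b ^+ 2 <= 1 / 4)%R.
  by have := @ler_pM R b (1/2) b (1/2) (ltW b0) (ltW b0) b1 b1; lra.
have b2 : (0 < b ^+ 2)%R by rewrite exprn_gt0.
rewrite expRN -div1r ler_pdivrMr ?expR_gt0//.
have := expR_ge1Dx (2 * b ^+ 2)%R.
move: (b ^+ 2)%R bb b2 => q q1 q0 h.
have : (0 <= (1 - q) * (expR (2 * q) - (1 + 2 * q)))%R by rewrite mulr_ge0 ?subr_ge0//; lra.
have : (0 <= q * (1 / 2 - q))%R by rewrite mulr_ge0 ?subr_ge0 ?(ltW q0)//; lra.
lra.
Qed.

Theorem theorem2p1 (R : realType) (n : nat) (d : measure_display)
    (T : measurableType d) (P : probability T R)
    (X : {RV P >-> n.-tuple (measurableTypeR R)})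
    (f : n.-tuple (measurableTypeR R) -> R) (eps : R) :
  (1 <= n)%N ->
  is_density X f ->
  log_concave f ->
  (0 <= eps <= 2)%R ->
  P [set w | eps%:E <=
       `| information_content f (X w) / n%:R%:E
          - shannon_entropy X f / n%:R%:E | ]
  <= (4 * expR (- (eps ^+ 2 * n%:R / 16)))%:E.
Proof.
move=> n1 dens lcf /andP[eps0 eps2]; have [mf f0 Xf] := dens.
have mfX : measurable_fun [set: T] (fun w => f (X w)).
  by exact: measurableT_comp.
pose L w := (- ln (f (X w)))%R.
have mL : measurable_fun [set: T] L.
  by apply: measurable_funN; exact: measurableT_comp.
have mN : measurable [set w | f (X w) = 0%R].
  by have := mfX measurableT _ (measurable_set1 0%R); rewrite setTI.
have infoE w : information_content f (X w) = if f (X w) == 0%R then +oo else (L w)%:E.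
  rewrite /information_content; case: ifPn => [/eqP ->|fN0].
    by rewrite le0_lneNy.
  by rewrite lne_EFin// lt0r fN0 f0.
have minfo : measurable_fun [set: T] (fun w => information_content f (X w)).
  under eq_fun do rewrite infoE.
  apply: measurable_fun_ifT => //; last exact/measurable_EFinP.
  exact: measurable_fun_eqr.
have mS : measurable [set w | eps%:E <=
       `| information_content f (X w) / n%:R%:E
          - shannon_entropy X f / n%:R%:E | ].
  rewrite -[Y in measurable Y]setTI; apply: emeasurable_fun_c_infty => //.
  apply: measurableT_comp => //; apply: emeasurable_funB => //.
  by under eq_fun do rewrite muleC; exact: measurable_funeM.
have [e0|epsN0] := eqVneq eps 0%R.
  apply: (@le_trans _ _ 1); first exact: probability_le1.
  by rewrite e0 expr0n/= !mul0r oppr0 expR0 mulr1 lee_fin ler1n.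
have eps_gt0 : (0 < eps)%R by rewrite lt0r epsN0.
(* Any b proportional to eps gives an exponent 2 b^2 - b eps, up to the factor n;
   it is minimal at eps / 4. *)
pose b := (eps / 4)%R; pose C := ((1 - b ^+ 2) ^+ n)%R.
have b0 : (0 < b)%R by rewrite /b; lra.
have b12 : (b <= 1 / 2)%R by rewrite /b; lra.
have Cge : (expR (- (2 * b ^+ 2 * n%:R)) <= C)%R.
  rewrite /C -mulNr expRM_natr lerXn2r ?nnegrE ?expR_ge0//.
    by apply: le_trans (expR_le_1BX _); rewrite ?expR_ge0// b0.
  by apply: expR_le_1BX; rewrite b0.
have C0 : (0 < C)%R by apply: lt_le_trans Cge; exact: expR_gt0.
have mass1 : \int[lebesgue_measure_tuple]_x (f x)%:E = 1.
  by rewrite -Xf//; exact: probability_setT.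
have CAB : C%:E * (\int[P]_w (expR (b * L w))%:E *
    \int[P]_w (expR (- b * L w))%:E) <= 1.
  rewrite !(density_moment mf f0 dens)//; last 2 first.
  - by apply/eqP; lra.
  - by apply/eqP; lra.
  rewrite opprK -[leRHS]mule1 -mass1; apply: log_concave_moments => //.
  by apply/andP; split; lra.
have iL := exp_moments_integrable_fun mL b0 C0 CAB.
have ent : shannon_entropy X f = \int[P]_w (L w)%:E.
  apply: ae_eq_integral => //; first exact/measurable_EFinP.
  exists [set w | f (X w) = 0%R]; split => //; first exact: density_eq0 dens.
  move=> w /=; apply: contra_notP => /eqP fN0 _.
  by rewrite infoE (negbTE fN0).
pose h := fine (\int[P]_w (L w)%:E).
have entE : shannon_entropy X f = h%:E.
  by rewrite ent fineK//; exact: integrable_fin_num iL.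
have n0 : (0 < n%:R :> R)%R by rewrite ltr0n.
have := exp_moments_concentration mL b0 C0 CAB (n%:R * eps).
rewrite -/h => conc.
have mD := measurable_deviation mL (n%:R * eps) h.
apply: (@le_trans _ _ (P ([set w | (n%:R * eps <= `|L w - h|)%R] `|`
    [set w | f (X w) = 0%R]))).
  apply: le_measure; rewrite ?inE//; first exact: measurableU.
  move=> w /=; rewrite infoE; case: ifPn => [/eqP fN0 _|fN0 H]; first by right.
  left; move: H; rewrite entE inver gt_eqF// -!EFinM -EFinB abse_EFin lee_fin.
  rewrite -mulrBl normrM [`|n%:R^-1|%R]gtr0_norm ?invr_gt0//.
  by rewrite ler_pdivlMr// mulrC.
apply: (le_trans (measureU2 _ _ _)) => //.
rewrite [Z in _ + Z](density_eq0 mf dens) adde0; apply: (le_trans conc); rewrite lee_fin.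
have CV : (C^-1 <= expR (2 * b ^+ 2 * n%:R))%R.
  by rewrite -[leRHS]invrK -expRN lef_pV2 ?posrE ?expR_gt0.
apply: (@le_trans _ _ (2 * expR (2 * b ^+ 2 * n%:R) * expR (- (b * (n%:R * eps))))%R).
  by rewrite ler_pM2r ?expR_gt0// ler_pM2l.
rewrite -mulrA -expRD; apply: ler_pM; rewrite ?expR_ge0//; first lra.
rewrite ler_expR /b.
have : (0 <= eps ^+ 2 * n%:R)%R by rewrite mulr_ge0 ?exprn_ge0 ?ltW.
lra.
Qed.
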